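(* $z_L(6,5)\ge 17$.
   Context: **Classical Zarankiewicz number.** For $m\ge n\ge 2$, $z(m,n)$ is the maximum number of edges in a bipartite graph with parts $S=[m]=\{1,\dots,m\}$ and $T=[n]=\{1,\dots,n\}$ that contains no $K_{2,2}$ (equivalently, no cycle $C_4$). **Limited augmented bipartite graphs.** Let $G_1=(S,T,E_1)$ with $S=[m]$, $T=[n]$ be a $C_4$-free bipartite graph with $|E_1|=z(m,n)$. A limited augmented bipartite graph $G=(S,T,E_1\cup E_2)$ augmented from $G_1$ consists of the set $E_1$ of 1-edges (pairs, or ''cells'', $(i,j)\in S\times T$) and a set $E_2$ of 2-edges. A 2-edge is a quadruple $(i,j;k,l)$ with $i,k\in S$, $j,l\in T$, where the case $i=k$ and $j=l$ is forbidden; it is regarded as an unordered pair of the two distinct cells $(i,j)$ and $(k,l)$, called its halves. It is nondegenerate if $i\ne k$ and $j\ne l$, row-degenerate if $i=k$ and $j\neq l$, and column-degenerate if $i\ne k$ and $j=l$. The simplicity condition is imposed: no 2-edge shares a cell with any 1-edge or with another 2-edge. **Generalized $C_4$-cycles.** A cell $(i,j)$ is occupied if $(i,j)\in E_1$ or $(i,j)$ is a half of some 2-edge in $E_2$. The graph $G$ contains a generalized $C_4$-cycle if any of the following holds: 1. There is a classical $C_4$-cycle formed by 1-edges. 2. There is a nondegenerate 2-edge $(i,j;k,l)\in E_2$ such that both cells $(i,l)$ and $(k,j)$ are occupied. 3. There are a 2-edge $(i,j;p,q)\in E_2$ (of any type) and a cell $(k,l)$ with $k\notin\{i,p\}$ and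 $l\notin\{j,q\}$ such that the five cells $(k,l),(k,j),(k,q),(i,l),(p,l)$ are all occupied; if the 2-edge is nondegenerate, these five cells must moreover be pairwise distinct. **Limited augmented Zarankiewicz number.** $z_L(m,n)$ is the maximum of $|E_1|+|E_2|$ over all $m\times n$ limited augmented bipartite graphs $G=(S,T,E_1\cup E_2)$ (augmented from a $C_4$-free graph with $|E_1|=z(m,n)$, satisfying the simplicity condition) that contain no generalized $C_4$-cycle. *)

(* Defs.v *)
From mathcomp Require Import all_boot.

Set Implicit Arguments.
Unset Strict Implicit.
Unset Printing Implicit Defensive.

Section LimitedAugmentedBipartiteGraphs.

Variables m n : nat.

Definition cell : finType := ('I_m * 'I_n)%type.

(* As the graph is bipartite with a given bipartition, a copy of C_4 = K_{2,2}
   is a choice of two rows and two columns whose four cells are all edges. *)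
Definition has_C4 (E : {set cell}) : bool :=
  [exists i : 'I_m, exists k : 'I_m, exists j : 'I_n, exists l : 'I_n,
    [&& i != k, j != l, (i, j) \in E, (i, l) \in E, (k, j) \in E
      & (k, l) \in E]].

Definition zarankiewicz : nat := \max_(E : {set cell} | ~~ has_C4 E) #|E|.

(* The 2-edge (i,j;k,l), an unordered pair of distinct cells, is the two-element
   set [set (i, j); (k, l)]. The last two conditions are simplicity. *)
Definition limited_augmented (E1 : {set cell}) (E2 : {set {set cell}}) : bool :=
  [&& ~~ has_C4 E1, #|E1| == zarankiewicz,
      [forall e in E2, #|e| == 2],
      [forall e in E2, [disjoint e & E1]]
    & trivIset E2].

Definition nondegenerate (c d : cell) : bool :=
  (c.1 != d.1) && (c.2 != d.2).

Definition occupied (E1 : {set cell}) (E2 : {set {set cell}}) : {set cell} :=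
  E1 :|: cover E2.

Definition crossing_C4 (E1 : {set cell}) (E2 : {set {set cell}}) : bool :=
  [exists i : 'I_m, exists j : 'I_n, exists k : 'I_m, exists l : 'I_n,
    [&& [set (i, j); (k, l)] \in E2, nondegenerate (i, j) (k, l),
        (i, l) \in occupied E1 E2 & (k, j) \in occupied E1 E2]].

(* For a degenerate 2-edge two of the five cells coincide, whence the
   distinctness requirement only in the nondegenerate case. *)
Definition five_cell_C4 (E1 : {set cell}) (E2 : {set {set cell}}) : bool :=
  [exists i : 'I_m, exists j : 'I_n, exists p : 'I_m, exists q : 'I_n,
   exists k : 'I_m, exists l : 'I_n,
    let cells := [:: (k, l); (k, j); (k, q); (i, l); (p, l)] in
    [&& [set (i, j); (p, q)] \in E2,
        k \notin [:: i; p], l \notin [:: j; q],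
        all [in occupied E1 E2] cells
      & nondegenerate (i, j) (p, q) ==> uniq cells]].

Definition has_generalized_C4 (E1 : {set cell}) (E2 : {set {set cell}}) :
  bool :=
  [|| has_C4 E1, crossing_C4 E1 E2 | five_cell_C4 E1 E2].

Definition limited_zarankiewicz : nat :=
  \max_(G : {set cell} * {set {set cell}}
        | limited_augmented G.1 G.2 && ~~ has_generalized_C4 G.1 G.2)
    (#|G.1| + #|G.2|).

End LimitedAugmentedBipartiteGraphs.

(* Main.v *)
Require Import Defs.
From mathcomp Require Import all_boot.

Set Implicit Arguments.
Unset Strict Implicit.
Unset Printing Implicit Defensive.

(** The Zarankiewicz number [z(6,5)] is 14, and an extremal graph exists that
    can be augmented by three 2-edges; hence [14 + 3 = 17].

    Upper bound (lemmas [C4_free_pairs] and [C4_free_6_5]): in a graph without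
    [C_4], two columns are joined to at most one common row, so the pairs of
    columns inside the neighbourhoods of the rows are all distinct, and the row
    degrees [d_i] satisfy [\sum_i 'C(d_i, 2) <= 'C(5, 2) = 10].  The chord of
    the parabola [d (d - 1) / 2] through [d = 2] and [d = 3] lies below it at
    all other integers, so [2 * d <= 'C(d, 2) + 3], and summing over the six
    rows yields [2 * |E| <= 10 + 18].

    Lower bound: equality forces the row neighbourhoods to decompose the
    complete graph on the five columns into two triangles and four edges.  The
    two triangles share a vertex, and this determines the 1-edges up to
    relabelling.  The 2-edges then have to be placed among the 16 empty cells;
    one solution, with cells of the same letter forming a 2-edge, is

      1 1 1 a .
      1 . b 1 1
      . 1 . 1 a
      b 1 . . 1
      . . 1 1 c
      . c 1 . 1

    and the absence of generalized [C_4]-cycles in it is a finite check. *)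

(** * Row degrees of graphs without four-cycles *)

Section UpperBound.

Variables m n : nat.
Implicit Types E : {set cell m n}.

Definition row_nbrs E (i : 'I_m) : {set 'I_n} := [set j | (i, j) \in E].

Lemma card_row_nbrs E : #|E| = \sum_i #|row_nbrs E i|.
Proof.
under eq_bigr => i _ do rewrite -sum1dep_card.
by rewrite pair_big_dep /= -sum1_card; apply: eq_bigl => -[].
Qed.

(** Both sides count incidences between rows [i] and pairs [A] of columns with
    [A \subset row_nbrs E i]: each row contributes ['C(d_i, 2)] of them, and
    each pair at most one, because two rows containing the same pair would form
    a [C_4]. *)
Lemma C4_free_pairs E :
  ~~ has_C4 E -> \sum_i 'C(#|row_nbrs E i|, 2) <= 'C(n, 2).
Proof.
move=> noC4.
under eq_bigr => i _ do rewrite -cards_draws -sum1dep_card big_mkcondl /=.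
rewrite exchange_big /= -[n in 'C(n, _)]card_ord -cardsT -cards_draws.
rewrite -sum1dep_card; under [leqRHS]eq_bigl => A do rewrite subsetT /=.
apply: leq_sum => A /cards2P[j [l [neq_jl ->{A}]]].
rewrite -big_mkcond sum1_card.
apply/card_le1_eqP => i k; rewrite !unfold_in /= !subUset !sub1set !inE.
move=> /andP[Eij Eil] /andP[Ekj Ekl]; apply/eqP; apply: contraNT noC4 => neq_ik.
apply/existsP; exists i; apply/existsP; exists k.
apply/existsP; exists j; apply/existsP; exists l.
by rewrite eq_sym neq_ik neq_jl Eij Eil Ekj Ekl.
Qed.

End UpperBound.

Lemma double_le_bin2 d : 2 * d <= 'C(d, 2) + 3.
Proof.
elim: d => // -[|[|d]] // IHd.
by rewrite mulnS binS bin1 addnAC addnC leq_add.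
Qed.

Lemma C4_free_6_5 (E : {set cell 6 5}) : ~~ has_C4 E -> #|E| <= 14.
Proof.
move=> /C4_free_pairs le10; rewrite -(leq_pmul2l (isT : 0 < 2)).
have /leq_trans-> // : 2 * #|E| <= \sum_i ('C(#|row_nbrs E i|, 2) + 3).
  by rewrite card_row_nbrs big_distrr leq_sum // => i _; apply: double_le_bin2.
rewrite big_split sum_nat_const card_ord /=.
by rewrite -[leqRHS]/('C(5, 2) + 18) leq_add2r.
Qed.

(** * Deciding properties of the cells of a grid *)

(** Enumerations of finite types do not reduce inside the kernel, but lists of
    natural numbers do, so statements about cells are moved to lists. *)
Definition all_cells m n (P : nat -> nat -> bool) : bool :=
  all (fun i => all (P i) (iota 0 n)) (iota 0 m).

Lemma all_cellsP m n (P : nat -> nat -> bool) :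
  all_cells m n P -> forall (i : 'I_m) (j : 'I_n), P i j.
Proof.
move=> /allP allP_rows i j.
have /allP-> //: all (P i) (iota 0 n) by rewrite allP_rows // mem_iota ltn_ord.
by rewrite mem_iota ltn_ord.
Qed.

Lemma card_cells m n (P : nat -> nat -> bool) :
  #|[set c : cell m n | P c.1 c.2]|
    = sumn [seq count (P i) (iota 0 n) | i <- iota 0 m].
Proof.
rewrite card_row_nbrs sumnE big_map -[m in iota 0 m]subn0 big_mkord.
apply: eq_bigr => i _; rewrite -val_enum_ord count_map cardE size_filter.
by rewrite enumT; apply: eq_count => j; rewrite !inE.
Qed.

(** * The augmented graph *)

(** The value 0 marks an empty cell, 1 a 1-edge, and each of 2, 3 and 4 the two
    halves of one 2-edge. *)
Definition label (i j : nat) : nat :=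
  nth 0 (nth [::] [:: [:: 1; 1; 1; 2; 0];
                      [:: 1; 0; 3; 1; 1];
                      [:: 0; 1; 0; 1; 2];
                      [:: 3; 1; 0; 0; 1];
                      [:: 0; 0; 1; 1; 4];
                      [:: 0; 4; 1; 0; 1]] i) j.

Definition label_class (s : nat) : {set cell 6 5} :=
  [set c : cell 6 5 | label c.1 c.2 == s].

Definition one_edges : {set cell 6 5} := label_class 1.

Definition two_edges : {set {set cell 6 5}} :=
  [set label_class s | s : 'I_5 & 1 < s].

Lemma card_label_class (s : 'I_5) :
  #|label_class s| = nth 0 [:: 10; 14; 2; 2; 2] s.
Proof.
rewrite /label_class (card_cells _ _ (fun i j => label i j == s)).
by case: s => -[|[|[|[|[|]]]]].
Qed.

Lemma card_two_edge e : e \in two_edges -> #|e| = 2.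
Proof.
by case/imsetP=> -[s lts5]; rewrite inE => gt1s ->; rewrite card_label_class;
  case: s lts5 gt1s => [|[|[|[|[|]]]]].
Qed.

(** Distinct labels have disjoint classes, which are nonempty for the labels of
    2-edges, so the classes are pairwise different. *)
Lemma card_two_edges : #|two_edges| = 3.
Proof.
rewrite card_in_imset => [|s t].
  by rewrite cardsE cardE /enum_mem size_filter -enumT
             -(count_map val (fun s => 1 < s)) val_enum_ord.
rewrite !inE => gt1s _ eq_st; apply/val_inj/eqP.
have /card_gt0P[c]: 0 < #|label_class s|.
  by rewrite card_two_edge //; apply: imset_f; rewrite inE.
by move=> sc; move: (sc); rewrite eq_st; move: sc; rewrite !inE => /eqP->.
Qed.

Lemma trivIset_two_edges : trivIset two_edges.
Proof.
apply/trivIsetP=> _ _ /imsetP[s _ ->] /imsetP[t _ ->] neq_st.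
rewrite -setI_eq0; apply: contraNT neq_st => /set0Pn[c].
by rewrite !inE => /andP[/eqP-> /eqP->].
Qed.

Lemma one_edges_C4_free : ~~ has_C4 one_edges.
Proof.
have chk : all_cells 6 5 (fun i j => all_cells 6 5 (fun k l =>
    ~~ [&& i != k, j != l, label i j == 1, label i l == 1, label k j == 1
         & label k l == 1])) by vm_compute.
apply/existsP=> -[i /existsP[k /existsP[j /existsP[l]]]]; rewrite !inE.
by apply/negP; apply: (all_cellsP (all_cellsP chk i j) k l).
Qed.

Lemma limited_augmented_witness : limited_augmented one_edges two_edges.
Proof.
have card14 : #|one_edges| = 14 := card_label_class (@Ordinal 5 1 isT).
apply/and5P; split.
- exact: one_edges_C4_free.
- rewrite eqn_leq; apply/andP; split.
    by apply: (leq_bigmax_cond one_edges); apply: one_edges_C4_free.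
  by rewrite card14; apply/bigmax_leqP=> E; apply: C4_free_6_5.
- by apply/forall_inP=> e /card_two_edge->.
- apply/forall_inP=> e /imsetP[s]; rewrite inE => gt1s -> {e}.
  rewrite disjoint_subset; apply/subsetP=> c; rewrite !inE => /eqP->.
  by rewrite gtn_eqF.
- exact: trivIset_two_edges.
Qed.

Lemma mem_occupied_witness c :
  c \in occupied one_edges two_edges -> label c.1 c.2 != 0.
Proof.
rewrite !inE => /orP[/eqP-> // | /bigcupP[e /imsetP[s]]].
by rewrite inE => gt1s -> {e}; rewrite inE => /eqP->; rewrite -lt0n ltnW.
Qed.

(** The 2-edges are label classes, so membership of a pair of cells in
    [two_edges] has a consequence that can be evaluated cell by cell. *)
Lemma two_edge_label c d :
  [set c; d] \in two_edges ->
  (1 < label c.1 c.2) && (label c.1 c.2 == label d.1 d.2).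
Proof.
case/imsetP=> s; rewrite inE => gt1s /setP eq_cd.
move: (eq_cd c) (eq_cd d); rewrite !inE !eqxx ?orbT.
by move=> /esym/eqP-> /esym/eqP->; rewrite gt1s eqxx.
Qed.

Lemma no_crossing_C4 : ~~ crossing_C4 one_edges two_edges.
Proof.
have chk : all_cells 6 5 (fun i j => all_cells 6 5 (fun k l =>
    ~~ [&& (1 < label i j) && (label i j == label k l),
           (i != k) && (j != l), label i l != 0 & label k j != 0])).
  by vm_compute.
apply/existsP=> -[i /existsP[j /existsP[k /existsP[l]]]].
case/and4P=> /two_edge_label lab nondeg.
move=> /mem_occupied_witness occ_il /mem_occupied_witness occ_kj.
apply: (negP (all_cellsP (all_cellsP chk i j) k l)).
by apply/and4P; split.
Qed.

(** Equality of labels does not exclude a repeated cell, so the condition that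
    the two halves differ enters the finite check separately; it comes from
    2-edges having two elements. *)
Lemma no_five_cell_C4 : ~~ five_cell_C4 one_edges two_edges.
Proof.
have chk : all_cells 6 5 (fun i j => all_cells 6 5 (fun p q =>
    [&& 1 < label i j, label i j == label p q & (i != p) || (j != q)] ==>
    all_cells 6 5 (fun k l =>
      ~~ [&& k \notin [:: i; p], l \notin [:: j; q],
             label k l != 0, label k j != 0, label k q != 0, label i l != 0
           & label p l != 0]))) by vm_compute.
apply/existsP=> -[i /existsP[j /existsP[p /existsP[q]]]].
case/existsP=> k /existsP[l] /=.
case/and5P=> ijpq k_out l_out /and5P[kl kj kq il /andP[pl _]] _.
have neq_ijpq : (i != p) || (j != q).
  rewrite -negb_and; apply/negP=> /andP[/eqP eq_ip /eqP eq_jq].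
  by have := card_two_edge ijpq; rewrite eq_ip eq_jq setUid cards1.
have /andP[gt1 eq_lab] := two_edge_label ijpq.
have /implyP chk_ijpq := all_cellsP (all_cellsP chk i j) p q.
have {}chk_ijpq := chk_ijpq (introT and3P (And3 gt1 eq_lab neq_ijpq)).
apply: (negP (all_cellsP chk_ijpq k l)).
rewrite (mem_occupied_witness kl) (mem_occupied_witness kj).
rewrite (mem_occupied_witness kq) (mem_occupied_witness il).
rewrite (mem_occupied_witness pl) !andbT.
by move: k_out l_out; rewrite !inE => -> ->.
Qed.

Theorem mainTheorem7 : 17 <= limited_zarankiewicz 6 5.
Proof.
have <- : #|one_edges| + #|two_edges| = 17.
  by rewrite card_two_edges (card_label_class (@Ordinal 5 1 isT)).
apply: (leq_bigmax_cond (one_edges, two_edges)).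
rewrite limited_augmented_witness /has_generalized_C4 !negb_or.
by rewrite one_edges_C4_free no_crossing_C4 no_five_cell_C4.
Qed.
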